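(* Suppose that $f_2,\ldots,f_N$ are strongly convex with convexity parameters $\sigma_2,\ldots,\sigma_N>0$, that $f_N$ is differentiable on $\mathbf{R}^{n_N}$ (so $\mathcal{X}_N=\mathbf{R}^{n_N}$) with $\nabla f_N$ Lipschitz continuous with constant $L_N$, and that $A_N$ has full row rank. Let $(x_1^*,\ldots,x_N^*,\lambda^* )\in\Omega^*$. If $\gamma>0$ satisfies $$\gamma < \min_{i=2,\ldots, N-1}\left\{\frac{4\sigma_{i}}{(2N-i)(i-1)\lambda_{\max}(A_{i}^\top A_{i})},\ \frac{4\sigma_{N}}{(N+1)(N-2)\lambda_{\max}(A_{N}^\top A_{N})}\right\},$$ then any sequence generated by the $N$-block ADMM satisfies, for every $k\ge 0$, $$\frac{\gamma}{2}\sum_{i=1}^{N-1}\Big\| \sum_{j=i+1}^{N}A_{j}(x_{j}^{*}-x_{j}^{k})\Big\|^{2}+\frac{1}{2\gamma}\|\lambda^*-\lambda^{k}\|^{2}\ \geq\ (1+\delta_1)\left(\frac{\gamma}{2}\sum_{i=1}^{N-1}\Big\| \sum_{j=i+1}^{N}A_{j}(x_{j}^{*}-x_{j}^{k+1})\Big\|^{2}+\frac{1}{2\gamma}\|\lambda^*-\lambda^{k+1}\|^{2}\right),$$ where $$\delta_1 := \min_{i=2,\ldots, N-1}\left\{\frac{4\sigma_i - \gamma(2N-i)(i-1)\lambda_{\max}(A_{i}^{\top}A_{i})}{\gamma(2N-i)(i-1)\lambda_{\max}(A_{i}^\top A_{i})},\ \frac{4\gamma\sigma_N- \gamma^2(N+1)(N-2)\lambda_{\max}(A_{N}^{\top}A_{N})}{2\lambda_{\min}^{-1}(A_{N}A_{N}^\top)L_N^{2}+\gamma^2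 N(N-1)\lambda_{\max}(A_{N}^\top A_{N})}\right\}>0.$$ Consequently $$\Big(\sum_{j=2}^{N}A_{j}x_{j}^{k},\ \sum_{j=3}^{N}A_{j}x_{j}^{k},\ \ldots,\ \sum_{j=N}^{N}A_{j}x_{j}^{k},\ \lambda^k\Big)$$ converges $Q$-linearly.
   Context: Setting. $N\ge 3$; $A_i\in\mathbf{R}^{p\times n_i}$, $b\in\mathbf{R}^p$; $\mathcal{X}_i\subset\mathbf{R}^{n_i}$ are closed convex sets and $\tilde f_i:\mathbf{R}^{n_i}\to\mathbf{R}$ are closed convex functions ($i=1,\ldots,N$). Put $f_i:=\tilde f_i+\mathbf{1}_i$, where $\mathbf{1}_i$ is $0$ on $\mathcal{X}_i$ and $+\infty$ outside. The problem is $\min \sum_{i=1}^N f_i(x_i)$ subject to $\sum_{i=1}^N A_ix_i=b$. $\Omega^*$ is the set of primal-dual optimal solutions, i.e. of $(x_1^*,\ldots,x_N^*,\lambda^* )$ with $A_i^\top\lambda^*\in\partial f_i(x_i^* )$ for $i=1,\ldots,N$ and $\sum_{i=1}^NA_ix_i^*=b$. It is assumed throughout that $\Omega^*\neq\emptyset$. Augmented Lagrangian, $\gamma>0$: $\mathcal{L}_\gamma(x_1,\ldots,x_N;\lambda)=\sum_i f_i(x_i)-\langle\lambda,\sum_iA_ix_i-b\rangle+\frac{\gamma}{2}\|\sum_iA_ix_i-b\|^2$. $N$-block ADMM: from $(x_2^0,\ldots,x_N^0,\lambda^0)$, for $k\ge0$ and successively $i=1,\ldots,N$, $x_i^{k+1}$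 is a minimizer over $x_i$ of $\mathcal{L}_\gamma(x_1^{k+1},\ldots,x_{i-1}^{k+1},x_i,x_{i+1}^k,\ldots,x_N^k;\lambda^k)$ (minimizers are taken to exist), and then $\lambda^{k+1}=\lambda^k-\gamma(\sum_{i=1}^NA_ix_i^{k+1}-b)$. The convexity parameter $\sigma_i$ of $f_i$ satisfies $(x-y)^\top(g_i(x)-g_i(y))\ge\sigma_i\|x-y\|^2$ for all $x,y\in\mathcal{X}_i$ and all subgradients $g_i(x)\in\partial f_i(x)$, $g_i(y)\in\partial f_i(y)$; strongly convex means $\sigma_i>0$. $\|\cdot\|$ is the Euclidean norm; $\lambda_{\max}(B),\lambda_{\min}(B)$ are the largest/smallest eigenvalues of a real symmetric matrix $B$, and $\lambda_{\min}^{-1}(B)=1/\lambda_{\min}(B)$. The minima in the claim are over all the ratios with $i=2,\ldots,N-1$ together with the last listed ratio. A ratio with zero denominator (possible if some $A_i=0$) is read as $+\infty$. $Q$-linear convergence of a sequence $u^k$ to $u^*$: for some norm (here the norm $|(w_2,\ldots,w_N,\lambda)|^2=\frac{\gamma}{2}\sum_i\|w_i\|^2+\frac1{2\gamma}\|\lambda\|^2$) there is $\rho\in(0,1)$ with $|u^{k+1}-u^*|\le\rho|u^k-u^*|$ for all $k$; here the limit is the tuple obtained by replacing $x_j^k,\lambda^k$ by $x_j^*,\lambda^*$. *)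

(* Defs.v *)
From HB Require Import structures.
From mathcomp Require Import all_boot all_order all_algebra.
From mathcomp Require Import all_classical all_reals all_analysis.

Set Implicit Arguments.
Unset Strict Implicit.
Unset Printing Implicit Defensive.

Import Order.TTheory GRing.Theory Num.Theory.
Import numFieldNormedType.Exports.

Local Open Scope classical_set_scope.
Local Open Scope ring_scope.

(* The blocks are numbered 1, ..., N: families such as [n], [A], [f] and [x]
   are functions on [nat] of which only the values at 1 <= i <= N are used. *)

Section Euclidean.
Context {R : realType}.

Definition dot n (u v : 'cV[R]_n) : R := \sum_i u i ord0 * v i ord0.

(* Not [`|u|], which is the maximum norm on matrices. *)
Definition enorm n (u : 'cV[R]_n) : R := Num.sqrt (dot u u).

(* Attained when [B] is symmetric and n > 0; both are 0 when n = 0. *)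
Definition lambda_max n (B : 'M[R]_n) : R := sup [set a | eigenvalue B a].
Definition lambda_min n (B : 'M[R]_n) : R := inf [set a | eigenvalue B a].

Definition grad n (f : 'cV[R]_n -> R) (x : 'cV[R]_n) : 'cV[R]_n :=
  \col_j 'D_(delta_mx j ord0) f x.

Definition lipschitz_grad n (f : 'cV[R]_n -> R) (L : R) :=
  forall x y, enorm (grad f x - grad f y) <= L * enorm (x - y).

End Euclidean.

Section ConvexAnalysis.
Context {R : realType}.
Local Open Scope ereal_scope.

Definition closed_convex_set n (X : set 'cV[R]_n) :=
  closed X /\ convex_set X.

Definition closed_convex_function n (f : 'cV[R]_n -> R) :=
  closed [set z : 'cV[R]_n * R | (f z.1 <= z.2)%R] /\
  convex_function [set: 'cV[R]_n] f.

Definition indicator n (X : set 'cV[R]_n) (x : 'cV[R]_n) : \bar R :=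
  if x \in X then 0 else +oo.

Definition constrained n (ft : 'cV[R]_n -> R) (X : set 'cV[R]_n)
  (x : 'cV[R]_n) : \bar R := (ft x)%:E + indicator X x.

(* Empty outside the effective domain. *)
Definition subdifferential n (f : 'cV[R]_n -> \bar R) (x : 'cV[R]_n) :
  set 'cV[R]_n :=
  [set g | f x \is a fin_num /\ forall y, f x + (dot g (y - x))%:E <= f y].

Definition convexity_parameter n (f : 'cV[R]_n -> \bar R) (X : set 'cV[R]_n)
  (sigma : R) :=
  forall x y g h, X x -> X y -> subdifferential f x g ->
    subdifferential f y h ->
    (sigma * enorm (x - y) ^+ 2 <= dot (x - y) (g - h))%R.

End ConvexAnalysis.

Section ADMM.
Context {R : realType}.
Variables (N p : nat) (n : nat -> nat) (A : forall i, 'M[R]_(p, n i)).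
Variables (b : 'cV[R]_p) (f : forall i, 'cV[R]_(n i) -> \bar R) (gamma : R).
Arguments f : clear implicits.

Definition residual (x : forall i, 'cV[R]_(n i)) : 'cV[R]_p :=
  \sum_(1 <= i < N.+1) A i *m x i - b.

Definition primal_dual_optimal (x : forall i, 'cV[R]_(n i))
  (lambda : 'cV[R]_p) :=
  (forall i, (1 <= i <= N)%N ->
     subdifferential (f i) (x i) ((A i)^T *m lambda)) /\
  \sum_(1 <= i < N.+1) A i *m x i = b.

Definition coupling (x : forall i, 'cV[R]_(n i)) (lambda : 'cV[R]_p) : R :=
  - dot lambda (residual x) + gamma / 2 * enorm (residual x) ^+ 2.

Definition aug_lagrangian (x : forall i, 'cV[R]_(n i)) (lambda : 'cV[R]_p) :
  \bar R :=
  (\sum_(1 <= i < N.+1) f i (x i) + (coupling x lambda)%:E)%E.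

(* The augmented Lagrangian as a function of the [i]-th block [z], the other
   blocks being those of [x], without its summands [f j (x j)], [j != i],
   which do not involve [z].  Keeping them would make it identically +oo when
   the starting point of the algorithm lies outside the constraint sets; see
   [block_objective_le] for the case where they are finite. *)
Definition block_objective (x : forall i, 'cV[R]_(n i)) (lambda : 'cV[R]_p)
  (i : nat) (z : 'cV[R]_(n i)) : \bar R :=
  (f i z + (coupling (eqtype.dfwith x z) lambda)%:E)%E.

Lemma block_objective_le x lambda i (z z' : 'cV[R]_(n i)) :
  (1 <= i <= N)%N ->
  (forall j, (1 <= j <= N)%N -> j != i -> f j (x j) \is a fin_num) ->
  (block_objective x lambda z <= block_objective x lambda z')%E =
  (aug_lagrangian (eqtype.dfwith x z) lambda <=
   aug_lagrangian (eqtype.dfwith x z') lambda)%E.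
Proof.
move=> /andP[i1 iN] fx.
pose c := (\sum_(1 <= j < N.+1 | j != i) f j (x j))%E.
have c_fin : c \is a fin_num.
  rewrite /c big_seq_cond; apply/sum_fin_numP => j _ /andP[].
  by rewrite mem_index_iota ltnS; exact: fx.
have E (w : 'cV[R]_(n i)) : aug_lagrangian (eqtype.dfwith x w) lambda =
           (c + block_objective x lambda w)%E.
  rewrite /aug_lagrangian /block_objective addeA; congr (_ + _)%E.
  rewrite (bigD1_seq i) ?iota_uniq//= ?mem_index_iota ?i1 ?ltnS//.
  rewrite eqtype.dfwith_in addeC; congr (_ + _)%E.
  by apply: eq_bigr => j ji; rewrite eqtype.dfwith_out // eq_sym.
by rewrite !E leeD2lE.
Qed.

Definition is_minimizer T (g : T -> \bar R) (z : T) :=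
  forall z', (g z <= g z')%E.

Definition admm (x : nat -> forall i, 'cV[R]_(n i))
  (lambda : nat -> 'cV[R]_p) :=
  forall k,
    (forall i, (1 <= i <= N)%N ->
       is_minimizer
         (@block_objective (fun j => if (j < i)%N then x k.+1 j else x k j)
            (lambda k) i)
         (x k.+1 i)) /\
    lambda k.+1 = lambda k - gamma *: residual (x k.+1).

End ADMM.

Section QLinear.
Context {R : realType}.

Definition is_norm (V : lmodType R) (nm : V -> R) :=
  [/\ forall u v, nm (u + v) <= nm u + nm v,
      forall a u, nm (a *: u) = `|a| * nm u
    & forall u, nm u = 0 -> u = 0].

Definition q_linearly_converges (V : lmodType R) (nm : V -> R)
  (u : nat -> V) (l : V) :=
  is_norm nm /\
  exists rho : R, [/\ 0 < rho, rho < 1 &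
    forall k, nm (u k.+1 - l) <= rho * nm (u k - l)].

End QLinear.

Section Rates.
Context {R : realType}.
Variables (N p : nat) (n : nat -> nat) (A : forall i, 'M[R]_(p, n i)).
Variables (sigma : nat -> R) (gamma : R).

Definition eratio (a d : R) : \bar R := if d == 0 then +oo%E else (a / d)%:E.

Definition gram_max (i : nat) : R := lambda_max ((A i)^T *m A i).

(* The subtractions are those of [nat]: they are exact for 2 <= i <= N. *)
Definition gamma_bound : \bar R :=
  Order.min
    (\big[Order.min/+oo%E]_(2 <= i < N)
       eratio (4 * sigma i) (((2 * N - i) * (i - 1))%N%:R * gram_max i))
    (eratio (4 * sigma N) (((N + 1) * (N - 2))%N%:R * gram_max N)).

Definition delta1 (L : R) : \bar R :=
  Order.min
    (\big[Order.min/+oo%E]_(2 <= i < N)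
       eratio (4 * sigma i
                - gamma * ((2 * N - i) * (i - 1))%N%:R * gram_max i)
             (gamma * ((2 * N - i) * (i - 1))%N%:R * gram_max i))
    (eratio (4 * gamma * sigma N
              - gamma ^+ 2 * ((N + 1) * (N - 2))%N%:R * gram_max N)
           (2 * (lambda_min (A N *m (A N)^T))^-1 * L ^+ 2
              + gamma ^+ 2 * (N * (N - 1))%N%:R * gram_max N)).

Definition potential (xs : forall i, 'cV[R]_(n i)) (ls : 'cV[R]_p)
  (x : forall i, 'cV[R]_(n i)) (lambda : 'cV[R]_p) : R :=
  gamma / 2 * (\sum_(1 <= i < N)
    enorm (\sum_(i.+1 <= j < N.+1) A j *m (xs j - x j)) ^+ 2)
  + 1 / (2 * gamma) * enorm (ls - lambda) ^+ 2.

(* The entry of index i : 'I_N.-1 is the partial sum that starts at i + 2. *)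
Definition tail_sums (x : forall i, 'cV[R]_(n i)) (lambda : 'cV[R]_p) :
  {ffun 'I_N.-1 -> 'cV[R]_p} * 'cV[R]_p :=
  ([ffun i : 'I_N.-1 => \sum_(i.+2 <= j < N.+1) A j *m x j], lambda).

Definition weighted_norm (u : {ffun 'I_N.-1 -> 'cV[R]_p} * 'cV[R]_p) : R :=
  Num.sqrt (gamma / 2 * (\sum_i enorm (u.1 i) ^+ 2)
            + 1 / (2 * gamma) * enorm u.2 ^+ 2).

End Rates.

(* Main.v *)
(* Write a_j = A_j (x_j^{k+1} - x_j^* ), mu = lambda^{k+1} - lambda^* , and let
   S_i, T_i be the sums over j > i of a_j and of A_j (x_j^{k+1} - x_j^k).  The
   optimality of the i-th block says that A_i^T (lambda^{k+1} + gamma T_i) is a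
   subgradient of f_i at x_i^{k+1}, so strong monotonicity gives
   sigma_i |x_i^{k+1} - x_i^*|^2 <= <a_i, mu + gamma T_i>.  Summing over i and
   completing squares (a_i = S_{i-1} - S_i), the potential decreases by at
   least sum_i sigma_i |x_i^{k+1} - x_i^*|^2 minus gamma/2 times the sum of
   |S_i|^2 over 1 <= i <= N-2.  By Cauchy-Schwarz that sum, as well as the one
   occurring in the new potential, is at most a weighted sum of the |a_j|^2; the
   remaining term |mu|^2 of the potential is controlled by
   |x_N^{k+1} - x_N^*|^2 because A_N^T mu is a difference of gradients of f_N. *)

Require Import Defs.
From HB Require Import structures.
From mathcomp Require Import all_boot all_order all_algebra.
From mathcomp Require Import all_classical all_reals all_analysis.
From mathcomp Require Import ring lra zify.

Import Order.TTheory GRing.Theory Num.Theory.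
Import numFieldNormedType.Exports.

Local Open Scope classical_set_scope.
Local Open Scope ring_scope.

Set Implicit Arguments.
Unset Strict Implicit.
Unset Printing Implicit Defensive.

(** * Inner products and extreme eigenvalues *)

Section Dot.
Context {R : realType} {n : nat}.
Implicit Types (u v w : 'cV[R]_n) (c : R).

Lemma dotC u v : dot u v = dot v u.
Proof. by apply: eq_bigr => i _; rewrite mulrC. Qed.

Lemma dotDr u v w : dot u (v + w) = dot u v + dot u w.
Proof. by rewrite -big_split; apply: eq_bigr => i _; rewrite mxE mulrDr. Qed.

Lemma dotZr c u v : dot u (c *: v) = c * dot u v.
Proof. by rewrite mulr_sumr; apply: eq_bigr => i _; rewrite mxE mulrCA. Qed.

Lemma dotNr u v : dot u (- v) = - dot u v.
Proof. by rewrite -scaleN1r dotZr mulN1r. Qed.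

Lemma dotDl u v w : dot (v + w) u = dot v u + dot w u.
Proof. by rewrite dotC dotDr !(dotC u). Qed.

Lemma dotZl c u v : dot (c *: v) u = c * dot v u.
Proof. by rewrite dotC dotZr dotC. Qed.

Lemma dotNl u v : dot (- v) u = - dot v u.
Proof. by rewrite dotC dotNr dotC. Qed.

Definition dotE := (dotDl, dotDr, dotNl, dotNr, dotZl, dotZr).

Lemma dot0r u : dot u 0 = 0.
Proof. by rewrite -(scale0r 0) dotZr mul0r. Qed.

Lemma dot0l u : dot 0 u = 0.
Proof. by rewrite dotC dot0r. Qed.

Lemma dot_sumr I (r : seq I) (P : pred I) (F : I -> 'cV[R]_n) u :
  dot u (\sum_(i <- r | P i) F i) = \sum_(i <- r | P i) dot u (F i).
Proof. exact: (big_morph _ (dotDr u) (dot0r u)). Qed.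

Lemma dot_ge0 u : 0 <= dot u u.
Proof. by apply: sumr_ge0 => i _; exact: sqr_ge0. Qed.

Lemma dot_eq0 u : dot u u = 0 -> u = 0.
Proof.
move/psumr_eq0P => h; apply/matrixP => i j; rewrite ord1 mxE.
by apply/eqP; rewrite -[_ == _]orbb -mulf_eq0 h// => k _; exact: sqr_ge0.
Qed.

Lemma dot_gt0 u : (0 < dot u u) = (u != 0).
Proof.
rewrite lt_neqAle dot_ge0 andbT eq_sym; congr (~~ _).
by apply/eqP/eqP => [/dot_eq0//|->]; rewrite dot0r.
Qed.

Lemma dot_delta u i : dot u (delta_mx i ord0) = u i ord0.
Proof.
rewrite /dot (bigD1 i)//= big1 => [|j ji]; first by rewrite mxE !eqxx mulr1 addr0.
by rewrite mxE (negbTE ji) mulr0.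
Qed.

Lemma enorm_sqr u : enorm u ^+ 2 = dot u u.
Proof. by rewrite sqr_sqrtr ?dot_ge0. Qed.

Lemma sqr_coord_le_dot u i : u i ord0 ^+ 2 <= dot u u.
Proof.
rewrite /dot (bigD1 i)//= -expr2 lerDl.
by apply: sumr_ge0 => j _; exact: sqr_ge0.
Qed.

End Dot.

Lemma dot_mulmx {R : realType} m n (B : 'M[R]_(m, n)) u v :
  dot u (B *m v) = dot (B^T *m u) v.
Proof.
have E k (w z : 'cV[R]_k) : dot w z = (w^T *m z) ord0 ord0.
  by rewrite mxE; apply: eq_bigr => i _; rewrite mxE.
by rewrite !E trmx_mul trmxK mulmxA.
Qed.

(** For small t the linear term dominates: a positive [a] is refuted at t = a / (q + 1), where
    adding 1 avoids a division by zero. *)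
Lemma linear_le_square {R : realFieldType} (a q : R) : 0 <= q ->
  (forall t, 2 * t * a <= t ^+ 2 * q) -> a <= 0.
Proof.
move=> q0 h; rewrite leNgt; apply/negP => a0.
have q1 : q + 1 != 0 by rewrite gt_eqF// ltr_wpDl.
have := h (a / (q + 1)); rewrite expr_div_n -subr_ge0.
have -> : a ^+ 2 / (q + 1) ^+ 2 * q - 2 * (a / (q + 1)) * a =
   - ((a / (q + 1)) ^+ 2 * (q + 2)) by field.
by rewrite oppr_ge0 leNgt mulr_gt0 ?exprn_gt0 ?divr_gt0//; lra.
Qed.

Section Rayleigh.
Context {R : realType}.

(** Stated on rows because the extreme value theorem [EVT_max_rV] is about rows. *)
Lemma quadratic_form_continuous n (B : 'M[R]_n) :
  continuous (fun v : 'rV[R]_n => dot v^T (B *m v^T)).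
Proof.
have coord i : continuous (fun v : 'rV[R]_n => v^T i ord0).
  by under eq_fun do rewrite mxE; exact: coord_continuous.
apply: continuous_big => [|i _ v]; first exact: add_continuous.
apply: continuousM; first exact: coord.
suff: continuous (fun v : 'rV[R]_n => (B *m v^T) i ord0) by exact.
under eq_fun do rewrite mxE.
apply: continuous_big => [|j _ w]; first exact: add_continuous.
by apply: continuousM; [exact: cst_continuous|exact: coord].
Qed.

Lemma unit_sphere_compact n : compact [set v : 'rV[R]_n | dot v^T v^T = 1].
Proof.
apply: bounded_closed_compact.
  (* The ambient norm is the maximum norm; each coordinate is bounded by the Euclidean norm, here
     1. *)
  exists 1; split=> // M M1 v /= v1; apply: le_trans (ltW M1).
  rewrite [leLHS]/Num.norm /= mx_normrE; apply/bigmax_leP; split=> // -[i j] _ /=.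
  rewrite -[leRHS]sqrtr1 -sqrtr_sqr ler_wsqrtr// -v1 ord1.
  by have := sqr_coord_le_dot v^T j; rewrite mxE.
have -> : [set v : 'rV[R]_n | dot v^T v^T = 1] =
    (fun v => dot v^T (1%:M *m v^T)) @^-1` [set 1].
  by apply/seteqP; split=> v /=; rewrite mul1mx.
apply: preimage_closed => [v _|]; first exact: quadratic_form_continuous.
exact: closed_eq.
Qed.

(* The maximum of the Rayleigh quotient is an eigenvalue: if it is attained at
   [c], the nonnegative form [M |e|^2 - <e, B e>] vanishes at [c], hence [c] is
   in its kernel. *)
Lemma max_eigenvalue n (B : 'M[R]_n) : (0 < n)%N -> B^T = B ->
  exists2 M, eigenvalue B M & forall e, dot e (B *m e) <= M * dot e e.
Proof.
case: n B => // n B _ BT.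
have [|||c] := @EVT_max_rV _ _ (fun v : 'rV[R]_n.+1 => dot v^T (B *m v^T))
    [set v | dot v^T v^T = 1].
- by exists (delta_mx ord0 ord0); rewrite /= trmx_delta dot_delta mxE !eqxx.
- exact: unit_sphere_compact.
- exact/continuous_subspaceT/quadratic_form_continuous.
rewrite inE /= => c1 cmax.
set M := dot _ _ in cmax.
have Mmax e : dot e (B *m e) <= M * dot e e.
  have [->|e0] := eqVneq e 0; first by rewrite mulmx0 dot0l mulr0.
  have d0 : 0 < dot e e by rewrite dot_gt0.
  pose s := (enorm e)^-1.
  have s2 : s ^+ 2 = (dot e e)^-1 by rewrite exprVn enorm_sqr.
  have := cmax (s *: e)^T; rewrite inE /= trmxK -scalemxAr !dotE !mulrA -expr2 s2.
  rewrite mulVf ?gt_eqF// => /(_ erefl).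
  by rewrite mulrC ler_pdivrMr.
exists M => //; have [w wE] : exists w, w = M *: c^T - B *m c^T by eexists.
suff w0 : w = 0.
  apply/eigenvalueP; exists c.
    apply: trmx_inj; rewrite trmx_mul BT linearZ /=.
    by apply/esym/subr0_eq; rewrite -wE.
  by apply/eqP => c0; move: c1; rewrite c0 trmx0 dot0l => /esym/eqP; rewrite oner_eq0.
apply: dot_eq0; apply/eqP; rewrite eq_le dot_ge0 andbT.
pose q := M * dot w w - dot w (B *m w).
have q0 : 0 <= q by rewrite subr_ge0.
(* Expansion of the nonnegative form at [c^T - t *: w]: the constant term vanishes and the linear
   term is -2t [dot w w]. *)
have h (t : R) : 2 * t * dot w w <= t ^+ 2 * q.
  have := Mmax (c^T - t *: w).
  have wB : dot c^T (B *m w) = dot w (B *m c^T) by rewrite dot_mulmx BT dotC.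
  have -> : dot w w = M * dot w c^T - dot w (B *m c^T) by rewrite {2}wE !dotE.
  rewrite mulmxBr -scalemxAr !dotE c1 -/M wB (dotC c^T w) /q.
  lra.
exact: (linear_le_square q0 h).
Qed.

Lemma mulmx_sqnorm_le m n (B : 'M[R]_(m, n)) (e : 'cV[R]_n) :
  dot (B *m e) (B *m e) <= lambda_max (B^T *m B) * dot e e.
Proof.
have [n0|n0] := posnP n.
  subst n; have -> : e = 0 by apply/matrixP => -[].
  by rewrite mulmx0 !dot0l mulr0.
have [|M eM Mmax] := @max_eigenvalue _ (B^T *m B) n0; first by rewrite trmx_mul trmxK.
rewrite dot_mulmx mulmxA dotC; apply: le_trans (Mmax e) _.
(* [sup] dominates only sets that are bounded above; the Rayleigh bound at an eigenvector shows that
   [M] bounds every eigenvalue. *)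
rewrite ler_wpM2r ?dot_ge0// /lambda_max; apply: ub_le_sup => //.
exists M => a /= /eigenvalueP[v vB v0].
have d0 : 0 < dot v^T v^T by rewrite dot_gt0 trmx_eq0.
have := Mmax v^T; have -> : (B^T *m B) *m v^T = a *: v^T.
  by apply: trmx_inj; rewrite !trmx_mul !trmxK vB linearZ /= trmxK.
by rewrite dotZr ler_pM2r.
Qed.

Lemma lambda_max_gram_ge0 m n (B : 'M[R]_(m, n)) : 0 <= lambda_max (B^T *m B).
Proof.
have [n0|n0] := posnP n; last first.
  have := mulmx_sqnorm_le B (delta_mx (Ordinal n0) ord0 : 'cV_n).
  by rewrite dot_delta mxE !eqxx mulr1; apply: le_trans; exact: dot_ge0.
(* A matrix of size 0 has no eigenvalue, and the supremum of the empty set is 0. *)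
subst n; rewrite /lambda_max (_ : [set _ | _] = set0) ?sup0//.
apply/seteqP; split=> // a /= /eigenvalueP[v _ /eqP]; apply.
by apply/matrixP => ? [].
Qed.

Lemma lambda_min_gram_ge0 m n (B : 'M[R]_(m, n)) : 0 <= lambda_min (B *m B^T).
Proof.
rewrite /lambda_min; set S := [set _ | _].
have [->|/set0P S0] := eqVneq S set0; first by rewrite inf0.
apply: lb_le_inf => // a /= /eigenvalueP[v vB v0].
have pos : 0 < dot v^T v^T by rewrite dot_gt0 trmx_eq0.
rewrite -(pmulr_lge0 _ pos) -dotZr -linearZ/= -vB trmx_mul trmx_mul trmxK.
by rewrite -mulmxA dot_mulmx dot_ge0.
Qed.


(** The smallest eigenvalue is obtained as minus the largest one of [- (B *m B^T)]. Row freeness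
    makes [B^T] injective, so this eigenvalue is positive and can be divided by. *)
Lemma sqnorm_le_trmx_mulmx m n (B : 'M[R]_(m, n)) (y : 'cV[R]_m) : row_free B ->
  dot y y <= (lambda_min (B *m B^T))^-1 * dot (B^T *m y) (B^T *m y).
Proof.
move=> fB; have [m0|m0] := posnP m.
  subst m; have -> : y = 0 by apply/matrixP => -[].
  by rewrite mulmx0 !dot0l mulr0.
have [|M eM Mmax] := @max_eigenvalue _ (- (B *m B^T)) m0.
  by rewrite linearN /= trmx_mul trmxK.
have sq (z : 'cV[R]_m) : dot (B^T *m z) (B^T *m z) = dot z (B *m B^T *m z).
  by rewrite dot_mulmx mulmxA trmxK dotC.
have low (z : 'cV[R]_m) : - M * dot z z <= dot (B^T *m z) (B^T *m z).
  by have := Mmax z; rewrite mulNmx dotNr -sq mulNr lerNl.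
have tr_eig (v : 'rV[R]_m) a : v *m (B *m B^T) = a *: v -> B *m B^T *m v^T = a *: v^T.
  by move=> vB; apply: trmx_inj; rewrite !trmx_mul !trmxK vB linearZ /= trmxK.
have pos (v : 'rV[R]_m) : v != 0 -> 0 < dot v^T v^T by rewrite dot_gt0 trmx_eq0.
have [v vB v0] := eigenvalueP eM.
have {}vB : v *m (B *m B^T) = - M *: v by rewrite scaleNr -vB mulmxN opprK.
have minE : lambda_min (B *m B^T) = - M.
  have lb : lbound [set a | eigenvalue (B *m B^T) a] (- M).
    move=> a /= /eigenvalueP[u uB u0]; have := low u^T.
    by rewrite sq (tr_eig _ _ uB) dotZr ler_pM2r ?pos.
  apply/eqP; rewrite eq_le; apply/andP; split.
    by apply: ge_inf; [exists (- M)|apply/eigenvalueP; exists v].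
  by apply: lb_le_inf => //; exists (- M); apply/eigenvalueP; exists v.
have M0 : 0 < - M.
  rewrite -(pmulr_lgt0 _ (pos _ v0)) -dotZr -(tr_eig _ _ vB) -sq.
  rewrite dot_gt0; apply: contra_neq v0 => Bv0; apply: (row_free_inj fB).
  rewrite mul0mx; apply: trmx_inj.
  by rewrite trmx_mul Bv0 trmx0.
by rewrite minE mulrC ler_pdivlMr// mulrC.
Qed.

End Rayleigh.

(** * Subgradients and optimality of the blocks *)

Section Subgradient.
Context {R : realType}.

Lemma constrained_in n (ft : 'cV[R]_n -> R) (X : set 'cV[R]_n) x :
  X x -> constrained ft X x = (ft x)%:E.
Proof. by move=> Xx; rewrite /constrained /indicator mem_set// adde0. Qed.

Lemma constrained_notin n (ft : 'cV[R]_n -> R) (X : set 'cV[R]_n) x :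
  ~ X x -> constrained ft X x = +oo%E.
Proof. by move=> Xx; rewrite /constrained /indicator memNset. Qed.

Lemma subdifferential_dom n (ft : 'cV[R]_n -> R) (X : set 'cV[R]_n) x g :
  subdifferential (constrained ft X) x g -> X x.
Proof.
by case=> + _; apply: contraTP => Xx; rewrite constrained_notin.
Qed.

(** Sum of the two subgradient inequalities. It serves block 1, for which no strong convexity is
    assumed. *)
Lemma subdifferential_monotone n (ft : 'cV[R]_n -> R) (X : set 'cV[R]_n) x y g h :
  subdifferential (constrained ft X) x g ->
  subdifferential (constrained ft X) y h -> 0 <= dot (x - y) (g - h).
Proof.
move=> gx hy; have Xx := subdifferential_dom gx; have Xy := subdifferential_dom hy.
move: gx hy => [_ /(_ y) +] [_ /(_ x) +].
rewrite !constrained_in// -!EFinD !lee_fin !dotE !(dotC g) !(dotC h).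
lra.
Qed.

(* Fermat's rule: along the segment from the minimizer [z] to a feasible [y],
   the first-order term has to be nonnegative. *)
Lemma minimizer_subgradient n (ft : 'cV[R]_n -> R) (X : set 'cV[R]_n)
    (q c : 'cV[R]_n -> R) (g z : 'cV[R]_n) :
  convex_set X -> convex_function [set: 'cV[R]_n] ft -> X !=set0 ->
  (forall d, 0 <= c d) ->
  (forall d t, q (z + t *: d) = q z - t * dot g d + t ^+ 2 * c d) ->
  is_minimizer (fun w => (constrained ft X w + (q w)%:E)%E) z ->
  subdifferential (constrained ft X) z g.
Proof.
move=> cvX cvf [w Xw] c0 qE zmin.
have Xz : X z.
  apply: contrapT => Xz; have := zmin w.
  by rewrite constrained_notin// constrained_in// -EFinD addye.
split=> [|y]; first by rewrite constrained_in.
have [Xy|Xy] := pselect (X y); last by rewrite (constrained_notin _ Xy) leey.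
rewrite !constrained_in// -EFinD lee_fin; set d := y - z.
(* [a] is the amount by which the subgradient inequality fails at [y]; convexity on the segment and
   minimality of [z] bound it by t [c d] for all t in (0, 1]. *)
rewrite -subr_le0; set a := (X in X <= 0); rewrite leNgt; apply/negP => a0.
have h (t : R) : 0 < t -> t <= 1 -> a <= t * c d.
  move=> t0 t1; pose s := Itv01 (ltW t0) t1.
  have sE : z + t *: d = conv s (y : convex_lmodType 'cV[R]_n) z.
    by rewrite /conv /= /d /unstable.onem scalerBr scalerBl scale1r addrCA.
  have Xs : X (z + t *: d) by rewrite sE; apply/set_mem/cvX; exact/mem_set.
  have cv : ft (z + t *: d) <= t * ft y + (1 - t) * ft z.
    by rewrite sE; exact: (cvf s y z (mem_set I) (mem_set I)).
  have := zmin (z + t *: d); rewrite !constrained_in// -!EFinD lee_fin qE => h1.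
  rewrite -(ler_pM2l t0) /a; lra.
have ac : 0 < a + c d by rewrite ltr_wpDr.
(* This t lies in (0, 1] and turns the bound into a (a + c d) <= a (c d), impossible for a > 0. *)
have := h (a / (a + c d)); rewrite divr_gt0// ler_pdivrMr// mul1r lerDl.
move=> /(_ isT (c0 d)).
rewrite mulrAC ler_pdivlMr// leNgt => /negP; apply.
by rewrite mulrDr ltrDr mulr_gt0.
Qed.

(** For h > 0 the difference quotient is at least [dot g v], so the two-sided limit is replaced by
    the right-hand one. *)
Lemma subgradient_le_derive n (f : 'cV[R]_n -> R) x g v :
  derivable f x v -> (forall y, f x + dot g (y - x) <= f y) ->
  dot g v <= 'D_v f x.
Proof.
move=> df sub; rewrite /derive.
set F := fun h : R => h^-1 *: _.
have cF : cvg (F @ 0^') by exact: df.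
rewrite (cvg_at_rightE _ _ cF).
apply: limr_ge.
  rewrite -(cvg_at_rightE _ _ cF).
  apply: cvg_trans cF; apply: cvg_app.
  move=> A [e egt0 Ae]; exists e => // t xe xgt0; apply: Ae => //.
  exact/lt0r_neq0.
near=> h.
have h0 : 0 < h by near: h; exact: nbhs_right_gt.
rewrite /F /= [leRHS]mulrC ler_pdivlMr// lerBrDl.
by apply: le_trans (sub _); rewrite addrK dotZr mulrC.
Unshelve. all: by end_near. Qed.

(** Differentiability makes the directional derivative odd in the direction, so the one-sided bounds
    at v and -v combine to an equality. *)
Lemma subgradient_grad n (f : 'cV[R]_n -> R) x g :
  differentiable f x -> (forall y, f x + dot g (y - x) <= f y) ->
  grad f x = g.
Proof.
move=> df sub; apply/matrixP => j k; rewrite ord1 mxE.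
have le v : dot g v <= 'D_v f x.
  by apply: subgradient_le_derive => //; exact: diff_derivable.
apply/eqP; rewrite -dot_delta eq_le le andbT -lerN2 -dotNr.
by apply: le_trans (le _) _; rewrite !deriveE// linearN.
Qed.

End Subgradient.

Section Iteration.
Context {R : realType}.
Variables (N p : nat) (n : nat -> nat) (A : forall i, 'M[R]_(p, n i)).
Variable b : 'cV[R]_p.

Lemma residual_dfwith (x : forall i, 'cV[R]_(n i)) i (w w' : 'cV[R]_(n i)) :
  (1 <= i <= N)%N ->
  residual N A b (eqtype.dfwith x w) =
  residual N A b (eqtype.dfwith x w') + A i *m (w - w').
Proof.
move=> iN; rewrite /residual !(bigD1_seq i) ?iota_uniq ?mem_index_iota ?ltnS//=.
rewrite !eqtype.dfwith_in mulmxBr.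
rewrite (eq_bigr (fun j => A j *m eqtype.dfwith x w' j)) => [|j ji].
  by rewrite [RHS]addrC -!addrA addKr.
by rewrite !eqtype.dfwith_out // eq_sym.
Qed.

Variables (X : forall i, set 'cV[R]_(n i)) (ft : forall i, 'cV[R]_(n i) -> R).
Variable gamma : R.
Variables (x : nat -> forall i, 'cV[R]_(n i)) (lambda : nat -> 'cV[R]_p).
Arguments ft : clear implicits.
Arguments X : clear implicits.
Arguments x : clear implicits.

(** Fermat's rule, the coupling being exactly quadratic in block i. Its gradient involves the
    residual [r] in which the blocks up to i are new and the later ones old; the multiplier update
    turns lambda^k - gamma r into the vector stated here. *)
Lemma admm_subgradient k i :
  0 <= gamma -> (1 <= i <= N)%N ->
  convex_set (X i) -> convex_function [set: 'cV[R]_(n i)] (ft i) ->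
  X i !=set0 ->
  admm N A b (fun i => constrained (ft i) (X i)) gamma x lambda ->
  subdifferential (constrained (ft i) (X i)) (x k.+1 i)
    ((A i)^T *m (lambda k.+1 +
       gamma *: \sum_(i.+1 <= j < N.+1) A j *m (x k.+1 j - x k j))).
Proof.
move=> gamma0 iN cvX cvf X0 /(_ k)[/(_ i iN) + lamE].
set mix := fun j => if _ then _ else _; set z := x k.+1 i => zmin.
set r := residual N A b (eqtype.dfwith mix z).
have rE : r = residual N A b (x k.+1) -
    \sum_(i.+1 <= j < N.+1) A j *m (x k.+1 j - x k j).
  have /andP[i1 iN'] := iN.
  have i1N : (i.+1 <= N.+1)%N by [].
  rewrite /r /residual !(@big_cat_nat _ _ _ i.+1 1 N.+1)//= -!addrA.
  congr (_ + _).
    apply: eq_big_nat => j /andP[_ ji]; have [->|ne] := eqVneq j i.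
      by rewrite eqtype.dfwith_in.
    by rewrite eqtype.dfwith_out 1?eq_sym// /mix ltn_neqAle ne -ltnS ji.
  rewrite [- b - _]addrC addrA; congr (_ - b); rewrite -sumrB.
  apply: eq_big_nat => j /andP[ij _].
  by rewrite eqtype.dfwith_out ?ltn_eqF// /mix ltnNge ltnW//= mulmxBr subKr.
have -> : (A i)^T *m (lambda k.+1 +
      gamma *: \sum_(i.+1 <= j < N.+1) A j *m (x k.+1 j - x k j)) =
    (A i)^T *m (lambda k - gamma *: r).
  rewrite lamE rE; move: (residual _ _ _ _) => s.
  by rewrite scalerBr opprB -addrA [- _ + _]addrC.
apply: (@minimizer_subgradient _ _ _ _
  (fun w => coupling N A b gamma (eqtype.dfwith mix w) (lambda k))
  (fun d => gamma / 2 * dot (A i *m d) (A i *m d))) => //.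
  by move=> d; rewrite mulr_ge0 ?divr_ge0 ?dot_ge0.
move=> d t; rewrite /coupling (residual_dfwith _ _ z iN) [z + _]addrC addrK.
rewrite !enorm_sqr -scalemxAr -/r; move: r {rE} => r.
rewrite !dotE -!dot_mulmx !dotE (dotC (_ *m d) r).
lra.
Qed.

End Iteration.

(** * Decrease of the potential *)

Section TailSums.
Context {R : realFieldType}.

(** Exchange of the order of summation over 1 <= i < j <= N. *)
Lemma sum_nat_triangle (c v : nat -> R) N :
  \sum_(1 <= i < N) c i * (\sum_(i.+1 <= j < N.+1) v j) =
  \sum_(2 <= j < N.+1) (\sum_(1 <= i < j) c i) * v j.
Proof.
elim: N => [|[|N] IH]; first by rewrite !big_geq.
  by rewrite !big_geq.
rewrite [RHS]big_nat_recr//= -IH big_nat_recr//= big_nat1.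
rewrite [in RHS](@big_nat_recr _ _ _ N.+1)//= mulrDl addrA; congr (_ + _).
rewrite mulr_suml -big_split/=; apply: eq_big_nat => i /andP[i1 iN].
by rewrite big_nat_recr//= ?mulrDr// ltnS ltnW.
Qed.

(** An arithmetic progression; this is the origin of the factors (2N - i)(i - 1) in the rates. *)
Lemma sum_subn_nat N j : (0 < j <= N)%N ->
  \sum_(1 <= i < j) (N - i)%:R = ((2 * N - j) * (j - 1))%N%:R / 2 :> R.
Proof.
case: j => // j; elim: j => [|j IH] jN; first by rewrite big_geq// muln0 mul0r.
rewrite big_nat_recr//= IH; last by lia.
by rewrite !subn1 /= !natrM !natrB; try lia; lra.
Qed.

End TailSums.

Section Descent.
Context {R : realType} {p : nat}.
Implicit Types (a v : nat -> 'cV[R]_p) (mu : 'cV[R]_p).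

(** The square expands into a double sum, in which <a_i, a_j> is at most (|a_i|^2 + |a_j|^2) / 2. *)
Lemma sqnorm_sum_le (r : seq nat) a :
  dot (\sum_(i <- r) a i) (\sum_(i <- r) a i) <=
  (size r)%:R * \sum_(i <- r) dot (a i) (a i).
Proof.
set S := \sum_(i <- r) dot (a i) (a i).
have row i : \sum_(j <- r) (dot (a i) (a i) + dot (a j) (a j)) / 2 =
    ((size r)%:R * dot (a i) (a i) + S) / 2.
  rewrite -mulr_suml big_split/= big_const_seq count_predT iter_addr_0.
  by rewrite mulr_natl.
have -> : (size r)%:R * S =
    \sum_(i <- r) \sum_(j <- r) (dot (a i) (a i) + dot (a j) (a j)) / 2.
  under [RHS]eq_bigr do rewrite row.
  rewrite -mulr_suml big_split/= -mulr_sumr big_const_seq count_predT.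
  by rewrite iter_addr_0 -[S *+ _]mulr_natl -/S; lra.
rewrite dot_sumr; apply: ler_sum => i _; rewrite dotC dot_sumr.
apply: ler_sum => j _; have := dot_ge0 (a i - a j).
rewrite !dotE (dotC (a j)); lra.
Qed.

Variable N : nat.
Definition tail v i : 'cV[R]_p := \sum_(i.+1 <= j < N.+1) v j.

Lemma tailS v i : (i < N)%N -> tail v i = v i.+1 + tail v i.+1.
Proof. by move=> iN; rewrite /tail big_ltn. Qed.

(** [tail v i] has N - i summands, which is the factor lost by Cauchy-Schwarz; exchanging the sums
    collects these factors for each [v j]. *)
Lemma sum_tail_sqnorm_le v :
  \sum_(1 <= i < N) dot (tail v i) (tail v i) <=
  \sum_(2 <= j < N.+1) ((2 * N - j) * (j - 1))%N%:R / 2 * dot (v j) (v j).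
Proof.
apply: (@le_trans _ _ (\sum_(1 <= i < N)
    (N - i)%:R * \sum_(i.+1 <= j < N.+1) dot (v j) (v j))).
  apply: ler_sum => i _; apply: le_trans (sqnorm_sum_le _ _) _.
  by rewrite size_iota subSS.
rewrite sum_nat_triangle; apply: ler_sum_nat => j /andP[j2 jN].
by rewrite sum_subn_nat// (ltnW j2).
Qed.

Variable gamma : R.

(** The potential in terms of [v j := A j *m (x j - xs j)] and [mu := l - ls]; see [potentialE]. *)
Definition lyapunov v mu : R :=
  gamma / 2 * (\sum_(1 <= i < N) dot (tail v i) (tail v i)) +
  1 / (2 * gamma) * dot mu mu.

Lemma lyapunov_ge0 v mu : 0 <= gamma -> 0 <= lyapunov v mu.
Proof.
move=> g0; rewrite addr_ge0// mulr_ge0 ?dot_ge0//; first lra.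
  by apply: sumr_ge0 => i _; exact: dot_ge0.
by rewrite divr_ge0 ?mulr_ge0.
Qed.

(* Since [v i = tail v i.-1 - tail v i], completing the square bounds each
   summand; the bounds telescope up to [|tail v 0|^2], which the multiplier
   update absorbs. *)
Lemma lyapunov_descent v w mu mu' : (1 < N)%N -> 0 < gamma ->
  mu = mu' + gamma *: \sum_(1 <= j < N.+1) v j ->
  \sum_(1 <= i < N.+1) dot (v i) (mu' + gamma *: (tail v i - tail w i)) +
    lyapunov v mu' <=
  lyapunov w mu + gamma / 2 *
    ((\sum_(1 <= i < N) dot (tail v i) (tail v i)) - dot (v N) (v N)).
Proof.
move=> N1 gamma0 muE.
pose sq (u : 'cV[R]_p) := dot u u.
(* The two sides differ by gamma / 2 times the square of [v i.+1 + tail w i.+1]. *)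
have step i : (i.+1 < N)%N -> gamma * dot (v i.+1) (tail v i.+1 - tail w i.+1)
    + gamma / 2 * sq (tail v i.+1) <=
    gamma / 2 * sq (tail w i.+1) + gamma / 2 * sq (tail v i).
  move=> iN; rewrite /sq (tailS _ (ltnW iN)).
  move: (v i.+1) (tail v i.+1) (tail w i.+1) => x y z.
  have := mulr_ge0 (ltW gamma0) (dot_ge0 (x + z)).
  rewrite !dotE (dotC z x) (dotC y x); lra.
have steps : gamma * (\sum_(1 <= i < N) dot (v i) (tail v i - tail w i))
    + gamma / 2 * (\sum_(1 <= i < N) sq (tail v i)) <=
    gamma / 2 * (\sum_(1 <= i < N) sq (tail w i)) +
    gamma / 2 * (\sum_(0 <= i < N.-1) sq (tail v i)).
  rewrite !mulr_sumr -!big_split /= -(prednK (ltnW N1)) !big_add1 /= -big_split/=.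
  by apply: ler_sum_nat => i /andP[_ iN]; apply: step; lia.
(* The index shift leaves two boundary terms; the negative one, |v_N|^2, is kept because it improves
   the constant of the last block. *)
have s0 : \sum_(0 <= i < N.-1) sq (tail v i) =
    sq (tail v 0) + ((\sum_(1 <= i < N) sq (tail v i)) - sq (v N)).
  rewrite big_ltn; last by lia.
  have tN : tail v N.-1 = v N.
    by rewrite tailS ?prednK ?(ltnW N1)// /tail big_geq ?addr0.
  congr (_ + _); rewrite -tN -[in X in X - _](prednK (ltnW N1)).
  by rewrite big_nat_recr/= ?addrK// -ltnS prednK// ltnW.
have sumE : \sum_(1 <= i < N.+1) dot (v i) (mu' + gamma *: (tail v i - tail w i)) =
    dot (tail v 0) mu' + gamma * (\sum_(1 <= i < N) dot (v i) (tail v i - tail w i)).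
  under eq_bigr do rewrite dotDr dotZr.
  rewrite big_split/= -mulr_sumr; congr (_ + _ * _).
    by rewrite dotC dot_sumr; apply: eq_bigr => i _; rewrite dotC.
  rewrite big_nat_recr//=; last exact: ltnW.
  by rewrite /tail !(@big_geq _ _ _ N.+1)// subrr dot0r addr0.
(* Expanding |mu|^2 yields exactly the inner product in [sumE] and the square of [tail v 0] left by
   the telescoping. *)
have muE2 : 1 / (2 * gamma) * sq mu = 1 / (2 * gamma) * sq mu' +
    dot (tail v 0) mu' + gamma / 2 * sq (tail v 0).
  rewrite muE -/(tail v 0) /sq !dotE (dotC mu'); field; exact: lt0r_neq0.
rewrite sumE /lyapunov -/(sq mu) -/(sq mu') -/(sq (v N)) muE2.
move: steps; rewrite s0 /sq; lra.
Qed.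

End Descent.

Section Potential.
Context {R : realType}.
Variables (N p : nat) (n : nat -> nat) (A : forall i, 'M[R]_(p, n i)).
Variable gamma : R.
Implicit Types (x : forall i, 'cV[R]_(n i)) (l : 'cV[R]_p).

Lemma potentialE xs ls x l : potential N A gamma xs ls x l =
  lyapunov N gamma (fun j => A j *m (x j - xs j)) (l - ls).
Proof.
have dotBB m (u v : 'cV[R]_m) : dot (- u) (- u) = dot u u by rewrite !dotE opprK.
rewrite /potential /lyapunov enorm_sqr -(dotBB _ (ls - l) 0) opprB.
congr (_ * _ + _); apply: eq_bigr => i _; rewrite enorm_sqr -(dotBB _ _ 0).
rewrite /tail -sumrN.
by congr dot; apply: eq_bigr => j _; rewrite -mulmxN opprB.
Qed.

Lemma weighted_norm_tail_sums xs ls x l :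
  weighted_norm gamma (tail_sums N A x l - tail_sums N A xs ls) =
  Num.sqrt (potential N A gamma xs ls x l).
Proof.
rewrite potentialE /weighted_norm /lyapunov enorm_sqr; congr (Num.sqrt (_ * _ + _)).
rewrite big_add1 big_mkord; apply: eq_bigr => i _; rewrite enorm_sqr !ffunE -sumrB.
by congr dot; apply: eq_bigr => j _; rewrite mulmxBr.
Qed.

End Potential.

(** * From descent to contraction *)

Section Contraction.
Context {R : realType}.

(** Here [E j] stands for the squared error of block j, [La j] for the largest eigenvalue of its
    Gram matrix and [l] for the inverse of the smallest eigenvalue of A_N A_N^T. The last two
    hypotheses say that the gain [sigma j * E j] of each block pays for its share of the error term
    and of [d] times the new potential. *)
Lemma lyapunov_contraction p N (gamma d l L : R) (sigma La E : nat -> R)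
    (v : nat -> 'cV[R]_p) mu' (V : R) :
  (2 < N)%N -> 0 < gamma -> 0 <= d ->
  \sum_(2 <= j < N.+1) sigma j * E j + lyapunov N gamma v mu' <=
    V + gamma / 2 *
      ((\sum_(1 <= i < N) dot (tail N v i) (tail N v i)) - dot (v N) (v N)) ->
  (forall j, 0 <= E j) ->
  (forall j, dot (v j) (v j) <= La j * E j) ->
  dot mu' mu' <= l * (L ^+ 2 * E N) ->
  (forall j, (2 <= j < N)%N ->
    d * (gamma * ((2 * N - j) * (j - 1))%N%:R * La j) <=
    4 * sigma j - gamma * ((2 * N - j) * (j - 1))%N%:R * La j) ->
  d * (2 * l * L ^+ 2 + gamma ^+ 2 * (N * (N - 1))%N%:R * La N) <=
    4 * gamma * sigma N - gamma ^+ 2 * ((N + 1) * (N - 2))%N%:R * La N ->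
  (1 + d) * lyapunov N gamma v mu' <= V.
Proof.
move=> N2 gamma0 d0 desc E0 vE muE hmid hlast.
have := sum_tail_sqnorm_le N v.
set T := (X in X <= _) => TQ.
suff : (1 + d) * (gamma / 2) * T + d / (2 * gamma) * dot mu' mu' <=
    \sum_(2 <= j < N.+1) sigma j * E j + gamma / 2 * dot (v N) (v N).
  move: desc; rewrite /lyapunov -/T invfM; lra.
have c0 : 0 <= (1 + d) * (gamma / 2) by rewrite mulr_ge0 ?addr_ge0// divr_ge0// ltW.
have := ler_wpM2l c0 TQ.
rewrite !(@big_nat_recr _ _ _ N)/=; try exact: ltnW.
set S1 := (X in _ * (X + _)); set S2 := (X in _ -> _ <= X + _ + _).
(* Blocks 2 to N - 1. The 4 in [hmid] is the product of the halves in gamma / 2 and in the weight w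
   / 2. *)
have S12 : (1 + d) * (gamma / 2) * S1 <= S2.
  rewrite mulr_sumr; apply: ler_sum_nat => j jN.
  set w : R := (_ * _)%N%:R; have w0 : 0 <= w by exact: ler0n.
  have := hmid j jN; rewrite -/w => hj.
  apply: (@le_trans _ _ ((1 + d) * (gamma / 2) * (w / 2) * (La j * E j))).
    by rewrite [leLHS]mulrA ler_wpM2l// mulr_ge0 ?divr_ge0.
  rewrite [leLHS]mulrA ler_wpM2r//; lra.
have -> : (2 * N - N = N)%N by lia.
set w : R := (_ * _)%N%:R; have w1 : 1 <= w / 2.
  rewrite ler_pdivlMr// mul1r ler_nat; nia.
(* For j = N the weight is w = N (N - 1); the shift by 2 comes from the term gamma / 2 |v_N|^2
   gained in the descent. *)
have wE : ((N + 1) * (N - 2))%N%:R = w - 2 :> R.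
  rewrite /w -[2 in RHS]/(2%:R) -natrB; last by nia.
  by congr _%:R; nia.
move: hlast; rewrite -/w wE => hlast h.
suff : ((1 + d) * (w / 2) - 1) * (gamma / 2) * dot (v N) (v N)
    + d / (2 * gamma) * dot mu' mu' <= sigma N * E N by move: S12 h; lra.
have f0 : 0 <= ((1 + d) * (w / 2) - 1) * (gamma / 2).
  rewrite mulr_ge0//; last by rewrite divr_ge0 ?ltW.
  by rewrite subr_ge0 mulrDl mul1r ler_wpDr// mulr_ge0// (le_trans _ w1).
have g0 : 0 <= d / (2 * gamma) by rewrite divr_ge0// mulr_ge0 ?ltW.
apply: le_trans (lerD (ler_wpM2l f0 (vE N)) (ler_wpM2l g0 muE)) _.
rewrite !mulrA -mulrDl ler_wpM2r//.
(* Multiplied by 4 gamma, the inequality for block N becomes [hlast]. *)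
rewrite -(ler_pM2l gamma0) -(@ler_pM2l _ 4)//.
rewrite (_ : 4 * (gamma * _) = 2 * gamma ^+ 2 * ((1 + d) * (w / 2) - 1) * La N
   + d * 2 * l * L ^+ 2); first lra.
by field; exact: lt0r_neq0.
Qed.

End Contraction.

(** * Rates *)

Section Ratios.
Context {R : realType}.

(** When q = 0 the ratio is +oo and the first hypothesis says nothing; the product is then 0 and the
    sign of [a] suffices. *)
Lemma le_eratio (d a q : R) : (d%:E <= eratio a q)%E -> 0 <= a -> 0 <= q ->
  d * q <= a.
Proof.
rewrite /eratio => + a0; case: eqP => [->|/eqP q0]; first by rewrite mulr0.
rewrite lee_fin => h; rewrite le0r (negbTE q0)/= => qp.
by rewrite -ler_pdivlMr.
Qed.

Lemma lt_eratio (d a q : R) : (d%:E < eratio a q)%E -> 0 < a -> 0 <= q ->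
  d * q < a.
Proof.
rewrite /eratio => + a0; case: eqP => [->|/eqP q0]; first by rewrite mulr0.
rewrite lte_fin => h; rewrite le0r (negbTE q0)/= => qp.
by rewrite -ltr_pdivlMr.
Qed.

Lemma eratio_gt0 (a q : R) : 0 < a -> 0 <= q -> (0 < eratio a q)%E.
Proof.
rewrite /eratio => a0; case: eqP => [//|/eqP q0]; rewrite le0r (negbTE q0)/= => qp.
by rewrite lte_fin divr_gt0.
Qed.

Lemma lt_bigmin_nat (F : nat -> \bar R) (d : \bar R) m n :
  (d < \big[Order.min/+oo%E]_(m <= i < n) F i)%E ->
  forall i, (m <= i < n)%N -> (d < F i)%E.
Proof.
move=> h i mi; move: h; rewrite (bigD1_seq i) ?iota_uniq ?mem_index_iota//=.
by rewrite lt_min => /andP[].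
Qed.

Lemma le_bigmin_nat (F : nat -> \bar R) (d : \bar R) m n :
  (d <= \big[Order.min/+oo%E]_(m <= i < n) F i)%E ->
  forall i, (m <= i < n)%N -> (d <= F i)%E.
Proof.
move=> h i mi; move: h; rewrite (bigD1_seq i) ?iota_uniq ?mem_index_iota//=.
by rewrite le_min => /andP[].
Qed.

End Ratios.

(** * The weighted Euclidean norm on tuples of tail sums and multipliers *)

Section WeightedNorm.
Context {R : realType}.
Variables (N p : nat) (gamma : R).
Hypothesis gamma0 : 0 < gamma.

Let V := ({ffun 'I_N.-1 -> 'cV[R]_p} * 'cV[R]_p)%type.

(** The inner product that induces [weighted_norm]; its Cauchy-Schwarz inequality gives the triangle
    inequality. *)
Let form (u v : V) : R :=
  gamma / 2 * (\sum_i dot (u.1 i) (v.1 i)) + 1 / (2 * gamma) * dot u.2 v.2.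

Let weighted_normE u : @weighted_norm R N p gamma u = Num.sqrt (form u u).
Proof.
by rewrite /weighted_norm enorm_sqr; under eq_bigr do rewrite enorm_sqr.
Qed.

Let formD (u v w : V) : form u (v + w) = form u v + form u w.
Proof.
rewrite /form dotDr; under eq_bigr do rewrite ffunE dotDr.
by rewrite big_split/=; lra.
Qed.

Let formZ c (u v : V) : form u (c *: v) = c * form u v.
Proof.
rewrite /form dotZr; under eq_bigr do rewrite ffunE dotZr.
by rewrite -mulr_sumr; lra.
Qed.

Let formC (u v : V) : form u v = form v u.
Proof. by rewrite /form dotC; under eq_bigr do rewrite dotC. Qed.

Let form_ge0 (u : V) : 0 <= form u u.
Proof.
rewrite addr_ge0// mulr_ge0 ?dot_ge0//; first by rewrite divr_ge0 ?ltW.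
  by apply: sumr_ge0 => i _; exact: dot_ge0.
by rewrite divr_ge0// mulr_ge0 ?ltW.
Qed.

Let form_quad (u v : V) t :
  form (t *: u + v) (t *: u + v) = t ^+ 2 * form u u + 2 * t * form u v + form v v.
Proof.
rewrite formD formZ ![form (_ + _) _]formC !formD !formZ (formC v u); lra.
Qed.

Lemma weighted_norm_is_norm : is_norm (@weighted_norm R N p gamma).
Proof.
split=> [u v|a u|u]; rewrite !weighted_normE.
- have cs : form u v <= Num.sqrt (form u u) * Num.sqrt (form v v).
    apply: le_trans (ler_norm _) _; rewrite -sqrtr_sqr -sqrtrM// ler_sqrt ?mulr_ge0//.
    rewrite -subr_ge0.
    (* If [form u u] is 0, the quadratic in t is affine and nonnegative, which forces
       [form u v = 0]; otherwise it is evaluated at its minimizer. *)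
    have [u0|u0] := eqVneq (form u u) 0.
      rewrite u0 mul0r.
      have h t : 2 * t * (- form u v) <= t ^+ 2 * 0 + form v v.
        by have := form_ge0 (t *: u + v); rewrite form_quad u0; lra.
      have [uv|uv] := eqVneq (form u v) 0; first by rewrite uv expr0n subrr.
      have := h (- (form v v + 1) / form u v).
      rewrite (_ : 2 * _ * _ = 2 * (form v v + 1)); last by field.
      by have := form_ge0 v; lra.
    have := form_ge0 ((- form u v / form u u) *: u + v); rewrite form_quad.
    rewrite (_ : _ + form v v =
      (form u u * form v v - form u v ^+ 2) / form u u); last by field.
    by rewrite pmulr_lge0// invr_gt0 lt_neqAle eq_sym u0 form_ge0.
  rewrite -[leRHS]ger0_norm ?addr_ge0 ?sqrtr_ge0// -sqrtr_sqr ler_sqrt ?sqr_ge0//.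
  rewrite sqrrD !sqr_sqrtr// -[u in form (u + v)]scale1r -[u in form _ (u + v)]scale1r.
  by rewrite form_quad mulr_natl; lra.
- by rewrite formZ formC formZ mulrA -expr2 sqrtrM ?sqr_ge0// sqrtr_sqr.
- move/eqP; rewrite sqrtr_eq0 => f0.
  have s0 : 0 <= \sum_i dot (u.1 i) (u.1 i) by apply: sumr_ge0 => i _; exact: dot_ge0.
  have : form u u == 0 by rewrite eq_le f0 form_ge0.
  have c1 : 0 < gamma / 2 by rewrite divr_gt0.
  have c2 : 0 < 1 / (2 * gamma) by rewrite divr_gt0 ?mulr_gt0.
  rewrite paddr_eq0 ?(pmulr_rge0 _ c1) ?(pmulr_rge0 _ c2) ?dot_ge0//.
  rewrite mulf_eq0 (gt_eqF c1) mulf_eq0 (gt_eqF c2) /=.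
  move=> /andP[/eqP/psumr_eq0P u1 /eqP/dot_eq0 u2].
  case: u u1 u2 {f0 s0} => u1 u2 /= u10 ->; congr (_, _).
  apply/ffunP => i; rewrite ffunE; apply: dot_eq0; apply: u10 => // j _.
  exact: dot_ge0.
Qed.

End WeightedNorm.

(** * Linear convergence *)

Theorem theorem3p1 (R : realType) (N p : nat) (n : nat -> nat)
  (A : forall i : nat, 'M[R]_(p, n i)) (b : 'cV[R]_p)
  (X : forall i : nat, set 'cV[R]_(n i))
  (ft : forall i : nat, 'cV[R]_(n i) -> R)
  (sigma : nat -> R) (L gamma : R)
  (xs : forall i : nat, 'cV[R]_(n i)) (ls : 'cV[R]_p)
  (x : nat -> forall i : nat, 'cV[R]_(n i)) (lambda : nat -> 'cV[R]_p)
  (f := fun i : nat => constrained (ft i) (X i))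
  (hN : (3 <= N)%N)
  (hX : forall i, (1 <= i <= N)%N -> closed_convex_set (X i))
  (hft : forall i, (1 <= i <= N)%N -> closed_convex_function (ft i))
  (hsigma : forall i, (2 <= i <= N)%N ->
     0 < sigma i /\ convexity_parameter (f i) (X i) (sigma i))
  (hXN : X N = setT)
  (hdiff : forall y, differentiable (ft N) y)
  (hlip : lipschitz_grad (ft N) L)
  (hAN : row_free (A N))
  (hopt : primal_dual_optimal N A b f xs ls)
  (hgamma0 : 0 < gamma)
  (hgamma : (gamma%:E < gamma_bound N A sigma)%E)
  (hadmm : admm N A b f gamma x lambda) :
  [/\ (0 < delta1 N A sigma gamma L)%E,
      forall k : nat,
        ((1 + delta1 N A sigma gamma L)
           * (potential N A gamma xs ls (x k.+1) (lambda k.+1))%:E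
         <= (potential N A gamma xs ls (x k) (lambda k))%:E)%E
    & q_linearly_converges (@weighted_norm R N p gamma)
        (fun k => tail_sums N A (x k) (lambda k)) (tail_sums N A xs ls)].
Proof.
have N0 : (1 <= N <= N)%N by rewrite leqnn andbT (leq_trans _ hN).
have La0 i : 0 <= gram_max A i by exact: lambda_max_gram_ge0.
(* The bound on gamma amounts to positive numerators in [delta1]; the last one carries an additional
   factor gamma. *)
have [] : (forall i, (2 <= i < N)%N ->
      0 < 4 * sigma i - gamma * ((2 * N - i) * (i - 1))%N%:R * gram_max A i) /\
    0 < 4 * gamma * sigma N
      - gamma ^+ 2 * ((N + 1) * (N - 2))%N%:R * gram_max A N.
  move: hgamma; rewrite lt_min => /andP[hmid hlast]; split=> [i iN|].
    have [i2 iN'] := andP iN; have [s0 _] := hsigma i (introT andP (conj i2 (ltnW iN'))).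
    have := lt_eratio (lt_bigmin_nat hmid iN).
    by rewrite subr_gt0 -mulrA; apply; rewrite ?mulr_gt0 ?mulr_ge0.
  have [s0 _] := hsigma N (introT andP (conj (ltnW hN) (leqnn N))).
  have := lt_eratio hlast; set c := (X in gamma * X) => hc.
  rewrite (_ : _ - _ = gamma * (4 * sigma N - gamma * c)); last by rewrite /c; ring.
  by rewrite mulr_gt0// subr_gt0 hc ?mulr_gt0 ?mulr_ge0.
move=> num_mid num_last.
have li0 : 0 <= (lambda_min (A N *m (A N)^T))^-1.
  by rewrite invr_ge0 lambda_min_gram_ge0.
have den_mid i : 0 <= gamma * ((2 * N - i) * (i - 1))%N%:R * gram_max A i.
  by rewrite !mulr_ge0// ltW.
have den_last : 0 <= 2 * (lambda_min (A N *m (A N)^T))^-1 * L ^+ 2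
    + gamma ^+ 2 * (N * (N - 1))%N%:R * gram_max A N.
  apply: addr_ge0; first exact: mulr_ge0 (mulr_ge0 (ler0n _ 2) li0) (sqr_ge0 L).
  exact: mulr_ge0 (mulr_ge0 (sqr_ge0 gamma) (ler0n _ _)) (La0 N).
have delta_gt0 : (0 < delta1 N A sigma gamma L)%E.
  rewrite lt_min eratio_gt0// andbT big_seq_cond.
  elim/big_ind : _ => [//|y z y0 z0|i]; first by rewrite lt_min y0.
  by rewrite mem_index_iota andbT => iN; rewrite eratio_gt0// num_mid.
pose V k := potential N A gamma xs ls (x k) (lambda k).
have V0 k : 0 <= V k by rewrite /V potentialE lyapunov_ge0// ltW.
(* Stated for real [d], because [delta1] is +oo when all its denominators vanish. *)
have contraction (d : R) k : 0 <= d -> (d%:E <= delta1 N A sigma gamma L)%E ->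
    (1 + d) * V k.+1 <= V k.
  move=> d0; rewrite le_min => /andP[dmid dlast].
  have [hsub hfeas] := hopt.
  pose e j := x k.+1 j - xs j; pose v j := A j *m e j.
  pose w j := A j *m (x k j - xs j).
  have sub i : (1 <= i <= N)%N -> subdifferential (f i) (x k.+1 i)
      ((A i)^T *m (lambda k.+1 + gamma *: (tail N v i - tail N w i))).
    move=> iN; have [_ cX] := hX i iN; have [_ cf] := hft i iN.
    have X0 : X i !=set0 by exists (xs i); exact: subdifferential_dom (hsub i iN).
    have := admm_subgradient k (ltW hgamma0) iN cX cf X0 hadmm.
    rewrite /tail -sumrB; congr (subdifferential _ _ (_ *m (_ + _ *: _))).
    by apply: eq_bigr => j _; rewrite /v /w /e -mulmxBr opprB addrA subrK.
  have dotv i : dot (e i) ((A i)^T *m (lambda k.+1 + gamma *: (tail N v i - tail N w i))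
        - (A i)^T *m ls) =
      dot (v i) (lambda k.+1 - ls + gamma *: (tail N v i - tail N w i)).
    by rewrite -mulmxBr dot_mulmx trmxK addrAC.
  have mono i : (2 <= i <= N)%N -> sigma i * dot (e i) (e i) <=
      dot (v i) (lambda k.+1 - ls + gamma *: (tail N v i - tail N w i)).
    move=> /andP[i2 iN]; have i1N : (1 <= i <= N)%N by rewrite (ltnW i2).
    have [_ cp] := hsigma i (introT andP (conj i2 iN)).
    rewrite -dotv -enorm_sqr; apply: cp; [| |exact: sub|exact: hsub].
      exact: subdifferential_dom (sub _ _).
    exact: subdifferential_dom (hsub _ _).
  have mono1 : 0 <= dot (v 1%N)
      (lambda k.+1 - ls + gamma *: (tail N v 1 - tail N w 1)).
    have i1N : (1 <= 1 <= N)%N by case/andP: N0.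
    by rewrite -dotv; exact: subdifferential_monotone (sub _ i1N) (hsub _ i1N).
  have gradN z g : subdifferential (f N) z g -> grad (ft N) z = g.
    move=> [_ zg]; apply: subgradient_grad => // y; move: (zg y).
    by rewrite /f !constrained_in ?hXN// -EFinD lee_fin.
  have tailN (u : nat -> 'cV[R]_p) : tail N u N = 0 by rewrite /tail big_geq.
  (* For i = N the tails are empty, so A_N^T maps the multiplier error to a difference of gradients
     of [ft N]. The Lipschitz bound may be squared since its right side dominates a norm. *)
  have muE : dot (lambda k.+1 - ls) (lambda k.+1 - ls) <=
      (lambda_min (A N *m (A N)^T))^-1 * (L ^+ 2 * dot (e N) (e N)).
    apply: le_trans (sqnorm_le_trmx_mulmx _ hAN) _; rewrite ler_wpM2l//.
    rewrite -!enorm_sqr -exprMn mulmxBr.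
    have := sub N N0; rewrite !tailN subrr scaler0 addr0 => /gradN <-.
    rewrite -(gradN _ _ (hsub N N0)).
    have /= h := hlip (x k.+1 N) (xs N).
    by rewrite ler_sqr ?nnegrE ?sqrtr_ge0// (le_trans _ h)// sqrtr_ge0.
  rewrite /V [in leLHS]potentialE.
  apply: (@lyapunov_contraction _ _ _ _ _ _ L sigma (gram_max A)
    (fun j => dot (e j) (e j)) _ _ _ hN hgamma0 d0 _ _ _ muE) => //.
  - have muk : lambda k - ls = lambda k.+1 - ls + gamma *: \sum_(1 <= j < N.+1) v j.
      have [_ ->] := hadmm k; rewrite /v /e.
      under eq_bigr do rewrite mulmxBr.
      by rewrite sumrB hfeas addrAC -addrA [_ - ls]addrC addrA addrNK addrC.
    rewrite potentialE; apply: le_trans _ (lyapunov_descent w (ltnW hN) hgamma0 muk).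
    (* The nonnegative summand of block 1 is dropped; the others are bounded below by strong
       monotonicity. *)
    rewrite lerD2r [leRHS]big_ltn; last by case/andP: N0.
    rewrite ler_wpDl//; last exact: ler_sum_nat.
  - by move=> j; exact: dot_ge0.
  - by move=> j; exact: mulmx_sqnorm_le.
  - move=> j jN.
    exact: le_eratio (le_bigmin_nat dmid jN) (ltW (num_mid j jN)) (den_mid j).
  - exact: le_eratio dlast (ltW num_last) den_last.
split=> // [k|].
  move: delta_gt0 (contraction ^~ k); rewrite -/(V k) -/(V k.+1).
  case: (delta1 _ _ _ _ _) => [r|_ h|//]; last first.
    (* For [delta1] = +oo the contraction holds with every d >= 0; if V k.+1 were positive, d = V k
       / V k.+1 would give V k + V k.+1 <= V k. *)
    suff -> : V k.+1 = 0 by rewrite mule0 lee_fin.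
    apply/eqP; rewrite eq_le V0 andbT leNgt; apply/negP => V1.
    have := h (V k / V k.+1); rewrite divr_ge0// leey => /(_ isT isT).
    by rewrite mulrDl divfK ?gt_eqF// mul1r gerDr leNgt V1.
  rewrite lte_fin => r0 /(_ r (ltW r0) (lexx _)).
  by rewrite -EFinD -EFinM lee_fin.
split; first exact: weighted_norm_is_norm.
have [d d0 dle] : exists2 d : R, 0 < d & (d%:E <= delta1 N A sigma gamma L)%E.
  move: delta_gt0; case: (delta1 _ _ _ _ _) => [r r0|_|//]; first by exists r.
  by exists 1; rewrite ?ltr01 ?leey.
have d1 : 0 < 1 + d by rewrite addr_gt0.
(* The norm of the error is the square root of the potential, hence the square root in the rate. *)
exists (Num.sqrt (1 + d)^-1); split=> [||k].
- by rewrite sqrtr_gt0 invr_gt0.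
- by rewrite -[ltRHS]sqrtr1 ltr_sqrt// invf_lt1// ltrDl.
rewrite !weighted_norm_tail_sums -sqrtrM ?invr_ge0 ?(ltW d1)//.
rewrite ler_sqrt ?mulr_ge0 ?V0 ?invr_ge0 ?(ltW d1)//.
by rewrite mulrC ler_pdivlMr// mulrC; apply: contraction => //; exact: ltW.
Qed.
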